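(* Let $H$ be a Hopf algebra over a field $\Bbbk$, let $(D,\blacktriangleleft)$ be a right $H$-module coalgebra, let $C\subseteq D$ be a subcoalgebra, and let $\pi\colon D\to C$ be a comultiplicative projection satisfying $$\pi[\pi(x)\blacktriangleleft h]=\pi[\varepsilon(\pi(x_1))\,x_2\blacktriangleleft h]$$ for all $x\in C\blacktriangleleft H$ and all $h\in H$. Define the linear map $C\otimes H\to C$, $c\otimes h\mapsto c\leftharpoonup h:=\pi(c\blacktriangleleft h)$. Then $C$ is a right partial $H$-module coalgebra via $\leftharpoonup$.
   Context: All objects are over a field $\Bbbk$; coalgebras are coassociative and counital, with Sweedler notation $\Delta(c)=c_1\otimes c_2$ and counit $\varepsilon$. A right $H$-module coalgebra is a pair $(D,\blacktriangleleft)$ with $D$ a coalgebra and $\blacktriangleleft\colon D\otimes H\to D$ linear such that $d\blacktriangleleft 1_H=d$, $\Delta(d\blacktriangleleft h)=d_1\blacktriangleleft h_1\otimes d_2\blacktriangleleft h_2$, and $(d\blacktriangleleft h)\blacktriangleleft g=d\blacktriangleleft hg$ for all $d\in D$, $g,h\in H$. A right partial $H$-module coalgebra is a pair $(C,\leftharpoonup)$ with $C$ a coalgebra and $\leftharpoonup\colon C\otimes H\to C$ linear such that for all $c\in C$, $g,h\in H$: (1) $c\leftharpoonup 1_H=c$; (2) $\Delta(c\leftharpoonup h)=c_1\leftharpoonup h_1\otimes c_2\leftharpoonup h_2$; (3) $(c\leftharpoonup h)\leftharpoonup g=\varepsilon(c_1\leftharpoonup h_1)\,(c_2\leftharpoonup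 h_2g)$. $C\blacktriangleleft H$ denotes the linear span in $D$ of the elements $c\blacktriangleleft h$ with $c\in C$, $h\in H$. A projection $\pi\colon D\to C$ is a linear map that, viewed as a map $D\to D$, satisfies $\pi\circ\pi=\pi$ and has image $C$ (so $\pi(c)=c$ for $c\in C$). It is comultiplicative if $\Delta\circ\pi=(\pi\otimes\pi)\circ\Delta$ (it is not required to preserve counits). *)

(* Defs.v *)
From HB Require Import structures.
From mathcomp Require Import all_boot all_algebra.
From mathcomp Require Import boolp classical_sets.

Set Implicit Arguments.
Unset Strict Implicit.
Unset Printing Implicit Defensive.

Import GRing.Theory.

Local Open Scope classical_set_scope.
Local Open Scope quotient_scope.
Local Open Scope ring_scope.

Definition linear_span (K : fieldType) (V : lmodType K) (A : set V) : set V :=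
  [set x | exists s : seq (K * V),
     (forall p, p \in s -> A p.2) /\ x = \sum_(p <- s) p.1 *: p.2].

Section Tensor.
Variables (K : fieldType) (U V : lmodType K).

(* A list of pairs stands for the sum of the corresponding pure tensors. *)
Inductive teq : seq (U * V) -> seq (U * V) -> Prop :=
| teq_refl s : teq s s
| teq_sym s t : teq s t -> teq t s
| teq_trans s t r : teq s t -> teq t r -> teq s r
| teq_cat s1 s2 t1 t2 : teq s1 t1 -> teq s2 t2 -> teq (s1 ++ s2) (t1 ++ t2)
| teq_catC s t : teq (s ++ t) (t ++ s)
| teq_addl u1 u2 v : teq [:: (u1 + u2, v)] [:: (u1, v); (u2, v)]
| teq_addr u v1 v2 : teq [:: (u, v1 + v2)] [:: (u, v1); (u, v2)]
| teq_scale a u v : teq [:: (a *: u, v)] [:: (u, a *: v)]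
| teq_zero v : teq [:: (0, v)] [::].

Let teqb : rel (seq (U * V)) := fun s t => `[< teq s t >].

Let teqb_refl : reflexive teqb.
Proof. by move=> s; apply/asboolP; exact: teq_refl. Qed.

Let teqb_sym : symmetric teqb.
Proof. by move=> s t; apply/asboolP/asboolP; exact: teq_sym. Qed.

Let teqb_trans : transitive teqb.
Proof.
by move=> t s r /asboolP st /asboolP tr; apply/asboolP; exact: teq_trans tr.
Qed.

Canonical teq_equiv := EquivRel teqb teqb_refl teqb_sym teqb_trans.

Definition tensor := {eq_quot teq_equiv}.

HB.instance Definition _ := Choice.on tensor.
HB.instance Definition _ := EqQuotient.on tensor.

Definition tens (u : U) (v : V) : tensor := \pi_tensor [:: (u, v)].

Lemma pi_teqP s t : \pi_tensor s = \pi_tensor t <-> teq s t.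
Proof.
split; first by move/eqmodP => /asboolP.
by move=> h; apply/eqmodP/asboolP.
Qed.

Lemma teq_repr s : teq (repr (\pi_tensor s)) s.
Proof. by apply/pi_teqP; rewrite reprK. Qed.

Lemma teq_map_pair (h : U -> U) :
  {morph h : x y / x + y} -> (forall a, {morph h : x / a *: x}) ->
  forall s t, teq s t ->
  teq [seq (h p.1, p.2) | p <- s] [seq (h p.1, p.2) | p <- t].
Proof.
move=> hD hZ s t; elim=> {s t}.
- by move=> s; exact: teq_refl.
- by move=> s t _; exact: teq_sym.
- by move=> s t r _ h1 _; exact: teq_trans.
- by move=> s1 s2 t1 t2 _ h1 _ h2; rewrite !map_cat; exact: teq_cat.
- by move=> s t; rewrite !map_cat; exact: teq_catC.
- by move=> u1 u2 v /=; rewrite hD; exact: teq_addl.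
- by move=> u v1 v2 /=; exact: teq_addr.
- by move=> a u v /=; rewrite hZ; exact: teq_scale.
- by move=> v /=; rewrite -(scale0r 0) hZ scale0r; exact: teq_zero.
Qed.

Definition tensor_zero : tensor := \pi_tensor [::].
Definition tensor_add (x y : tensor) : tensor := \pi_tensor (repr x ++ repr y).
Definition tensor_opp (x : tensor) : tensor :=
  \pi_tensor [seq (- p.1, p.2) | p <- repr x].
Definition tensor_scale (a : K) (x : tensor) : tensor :=
  \pi_tensor [seq (a *: p.1, p.2) | p <- repr x].

Lemma tensor_addE s t :
  tensor_add (\pi_tensor s) (\pi_tensor t) = \pi_tensor (s ++ t).
Proof. by apply/pi_teqP/teq_cat; exact: teq_repr. Qed.

Lemma tensor_oppE s :
  tensor_opp (\pi_tensor s) = \pi_tensor [seq (- p.1, p.2) | p <- s].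
Proof.
apply/pi_teqP; apply: teq_map_pair (teq_repr _) => [x y|a x].
  by rewrite opprD.
by rewrite scalerN.
Qed.

Lemma tensor_scaleE a s :
  tensor_scale a (\pi_tensor s) = \pi_tensor [seq (a *: p.1, p.2) | p <- s].
Proof.
apply/pi_teqP; apply: teq_map_pair (teq_repr _) => [x y|b x].
  by rewrite scalerDr.
by rewrite !scalerA mulrC.
Qed.

Lemma tensor_ind_pi (P : tensor -> Prop) :
  (forall s, P (\pi_tensor s)) -> forall x, P x.
Proof. by move=> h x; rewrite -[x]reprK. Qed.

Lemma tensor_addA : associative tensor_add.
Proof.
elim/tensor_ind_pi=> s; elim/tensor_ind_pi=> t; elim/tensor_ind_pi=> r.
by rewrite !tensor_addE catA.
Qed.

Lemma tensor_addC : commutative tensor_add.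
Proof.
elim/tensor_ind_pi=> s; elim/tensor_ind_pi=> t.
by rewrite !tensor_addE; apply/pi_teqP; exact: teq_catC.
Qed.

Lemma tensor_add0 : left_id tensor_zero tensor_add.
Proof. by elim/tensor_ind_pi=> s; rewrite tensor_addE. Qed.

Lemma tensor_addN : left_inverse tensor_zero tensor_opp tensor_add.
Proof.
elim/tensor_ind_pi=> s; rewrite tensor_oppE tensor_addE; apply/pi_teqP.
elim: s => [|[u v] s ih] /=; first exact: teq_refl.
apply: (@teq_trans _ ([:: (- u, v)] ++ [:: (u, v)] ++
                      [seq (- p.1, p.2) | p <- s] ++ s)).
  rewrite -cat1s; apply: teq_cat (teq_refl _) _.
  rewrite -[(u, v) :: s]cat1s !catA; apply: teq_cat (teq_refl _).
  exact: teq_catC.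
rewrite catA -[X in teq _ X]cats0; apply: teq_cat ih.
apply: teq_trans (teq_zero v).
by rewrite -(addNr u); apply: teq_sym; exact: teq_addl.
Qed.

HB.instance Definition _ := GRing.isZmodule.Build tensor
  tensor_addA tensor_addC tensor_add0 tensor_addN.

Lemma tensor_scaleA a b x :
  tensor_scale a (tensor_scale b x) = tensor_scale (a * b) x.
Proof.
elim/tensor_ind_pi: x => s; rewrite !tensor_scaleE -map_comp.
by congr (\pi_tensor _); apply: eq_map => -[u v] /=; rewrite scalerA.
Qed.

Lemma tensor_scale1 : left_id 1 tensor_scale.
Proof.
elim/tensor_ind_pi=> s; rewrite tensor_scaleE; congr (\pi_tensor _).
by rewrite -[RHS]map_id; apply: eq_map => -[u v] /=; rewrite scale1r.
Qed.

Lemma tensor_scaleDr : right_distributive tensor_scale +%R.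
Proof.
move=> a; elim/tensor_ind_pi=> s; elim/tensor_ind_pi=> t.
by rewrite /GRing.add /= !(tensor_addE, tensor_scaleE) map_cat.
Qed.

Lemma tensor_scaleDl x : {morph tensor_scale^~ x : a b / a + b}.
Proof.
elim/tensor_ind_pi: x => s a b; rewrite {2}/GRing.add /=.
rewrite !tensor_scaleE tensor_addE.
apply/pi_teqP; elim: s => [|[u v] s ih] /=; first exact: teq_refl.
rewrite scalerDl -cat1s.
apply: (@teq_trans _ ([:: (a *: u, v); (b *: u, v)] ++
  [seq (a *: p.1, p.2) | p <- s] ++ [seq (b *: p.1, p.2) | p <- s])).
  by apply: teq_cat ih; exact: teq_addl.
set A := map _ s; set B := map _ s.
change (teq ([:: (a *: u, v)] ++ (([:: (b *: u, v)] ++ A) ++ B))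
            ([:: (a *: u, v)] ++ (A ++ [:: (b *: u, v)] ++ B))).
apply: teq_cat (teq_refl _) _; rewrite [A ++ _]catA.
by apply: teq_cat (teq_refl _); exact: teq_catC.
Qed.

HB.instance Definition _ := GRing.Zmodule_isLmodule.Build K tensor
  tensor_scaleA tensor_scale1 tensor_scaleDr tensor_scaleDl.

Lemma pi_tensorD s t : \pi_tensor s + \pi_tensor t = \pi_tensor (s ++ t).
Proof. exact: tensor_addE. Qed.

Lemma pi_tensorZ a s :
  a *: \pi_tensor s = \pi_tensor [seq (a *: p.1, p.2) | p <- s].
Proof. exact: tensor_scaleE. Qed.

Lemma tens_is_bilinear : bilinear_for *:%R *:%R tens.
Proof.
split=> w a x y /=; rewrite /tens pi_tensorZ pi_tensorD; apply/pi_teqP.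
  exact: teq_addl.
apply: teq_trans (teq_addr _ _ _) _.
rewrite -[X in teq X _]cat1s -[X in teq _ X]cat1s.
apply: teq_cat (teq_refl _).
by apply: teq_sym; exact: teq_scale.
Qed.

HB.instance Definition _ :=
  bilinear_isBilinear.Build K U V tensor _ _ tens tens_is_bilinear.

Lemma pi_tensorE s : \pi_tensor s = \sum_(p <- s) tens p.1 p.2.
Proof.
elim: s => [|[u v] s ih]; first by rewrite big_nil.
by rewrite big_cons -ih pi_tensorD.
Qed.

Lemma tensorE (x : tensor) : x = \sum_(p <- repr x) tens p.1 p.2.
Proof. by rewrite -pi_tensorE reprK. Qed.

(* The linear map induced by a bilinear f (tlift_tens, tlift_is_linear);     *)
(* unspecified when f is not bilinear.  tlift (fun x1 x2 => E) (comul x) is  *)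
(* the Sweedler expression E in x_1 and x_2.                                 *)
Definition tlift (W : lmodType K) (f : U -> V -> W) (x : tensor) : W :=
  \sum_(p <- repr x) f p.1 p.2.

Section Lift.
Variables (W : lmodType K) (f : U -> V -> W).
Hypothesis fB : bilinear_for *:%R *:%R f.

Let fDl v : {morph f^~ v : x y / x + y}.
Proof. by move=> x y; have := fB.1 v 1 x y; rewrite /= !scale1r. Qed.
Let fDr u : {morph f u : x y / x + y}.
Proof. by move=> x y; have := fB.2 u 1 x y; rewrite /= !scale1r. Qed.
Let f0l v : f 0 v = 0.
Proof. by apply: (addIr (f 0 v)); rewrite -fDl !add0r. Qed.
Let f0r u : f u 0 = 0.
Proof. by apply: (addIr (f u 0)); rewrite -fDr !add0r. Qed.
Let fZl a u v : f (a *: u) v = a *: f u v.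
Proof. by have := fB.1 v a u 0; rewrite /= !addr0 f0l addr0. Qed.
Let fZr a u v : f u (a *: v) = a *: f u v.
Proof. by have := fB.2 u a v 0; rewrite /= !addr0 f0r addr0. Qed.

Lemma tlift_teq s t : teq s t ->
  \sum_(p <- s) f p.1 p.2 = \sum_(p <- t) f p.1 p.2.
Proof.
elim=> {s t} //=.
- by move=> s t r _ -> _ ->.
- by move=> s1 s2 t1 t2 _ h1 _ h2; rewrite !big_cat /= h1 h2.
- by move=> s t; rewrite !big_cat /= addrC.
- by move=> u1 u2 v; rewrite !big_cons !big_nil /= fDl !addr0.
- by move=> u v1 v2; rewrite !big_cons !big_nil /= fDr !addr0.
- by move=> a u v; rewrite !big_cons !big_nil /= fZl fZr.
- by move=> v; rewrite big_cons big_nil /= f0l addr0.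
Qed.

Lemma tlift_pi s : tlift f (\pi_tensor s) = \sum_(p <- s) f p.1 p.2.
Proof. exact/tlift_teq/teq_repr. Qed.

Lemma tlift_tens u v : tlift f (tens u v) = f u v.
Proof. by rewrite tlift_pi big_cons big_nil /= addr0. Qed.

Lemma tlift_is_linear : linear (tlift f).
Proof.
move=> a; elim/tensor_ind_pi=> s; elim/tensor_ind_pi=> t.
rewrite pi_tensorZ pi_tensorD !tlift_pi big_cat big_map /=.
by congr (_ + _); rewrite scaler_sumr; apply: eq_bigr => p _; rewrite fZl.
Qed.

End Lift.

Lemma eq_tlift (W : lmodType K) (f g : U -> V -> W) :
  (forall u v, f u v = g u v) -> tlift f =1 tlift g.
Proof. by move=> fg x; apply: eq_bigr => p _; rewrite fg. Qed.

Lemma tensor_linear_ext (W : lmodType K) (f g : {linear tensor -> W}) :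
  (forall u v, f (tens u v) = g (tens u v)) -> f =1 g.
Proof.
move=> fg x; rewrite [x]tensorE !raddf_sum.
by apply: eq_bigr => p _; exact: fg.
Qed.

End Tensor.

Arguments tens {K U V}.
Notation "u ⊗ v" := (tens u v) (at level 40, left associativity) : ring_scope.

Section TensorMap.
Variables (K : fieldType) (U U' V V' : lmodType K).
Variables (f : {linear U -> U'}) (g : {linear V -> V'}).

Definition tmap : tensor U V -> tensor U' V' :=
  tlift (fun u v => f u ⊗ g v).

Fact tmap_subproof : bilinear_for *:%R *:%R (fun u v => f u ⊗ g v).
Proof.
by split=> w a x y /=; rewrite linearP ?linearPl ?linearPr.
Qed.

Lemma tmap_tens u v : tmap (u ⊗ v) = f u ⊗ g v.
Proof. exact/tlift_tens/tmap_subproof. Qed.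

HB.instance Definition _ := GRing.isLinear.Build K (tensor U V) (tensor U' V')
  *:%R tmap (tlift_is_linear tmap_subproof).

End TensorMap.

Section TensorAssoc.
Variables (K : fieldType) (U V W : lmodType K).

Let inner_bil (w : W) :
  bilinear_for *:%R *:%R (fun (u : U) (v : V) => u ⊗ (v ⊗ w)).
Proof.
by split=> z a x y /=; rewrite ?linearPl ?linearPr //= linearPl linearPr.
Qed.

Definition tassoc : tensor (tensor U V) W -> tensor U (tensor V W) :=
  tlift (fun t w => tlift (fun u v => u ⊗ (v ⊗ w)) t).

Fact tassoc_subproof : bilinear_for *:%R *:%R
  (fun (t : tensor U V) (w : W) => tlift (fun u v => u ⊗ (v ⊗ w)) t).
Proof.
split=> [w a x y|t a x y] /=; first exact: (tlift_is_linear (inner_bil w)).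
rewrite /tlift scaler_sumr -big_split /=; apply: eq_bigr => p _.
by rewrite !linearPr.
Qed.

Lemma tassoc_tens u v w : tassoc (u ⊗ v ⊗ w) = u ⊗ (v ⊗ w).
Proof.
by rewrite /tassoc (tlift_tens tassoc_subproof) (tlift_tens (inner_bil w)).
Qed.

HB.instance Definition _ := GRing.isLinear.Build K
  (tensor (tensor U V) W) (tensor U (tensor V W))
  *:%R tassoc (tlift_is_linear tassoc_subproof).

End TensorAssoc.

HB.mixin Record Lmodule_isCoalgebra (K : fieldType) C of GRing.Lmodule K C := {
  comul : {linear C -> tensor C C};
  counit : {scalar C};
  comulA : forall c : C,
    tassoc (tmap comul idfun (comul c)) = tmap idfun comul (comul c);
  counitl : forall c : C, tlift (fun c1 c2 => counit c1 *: c2) (comul c) = c;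
  counitr : forall c : C, tlift (fun c1 c2 => counit c2 *: c1) (comul c) = c
}.

#[short(type="coalgType")]
HB.structure Definition Coalgebra (K : fieldType) :=
  {C of Lmodule_isCoalgebra K C & GRing.Lmodule K C}.

HB.mixin Record isBialgebra (K : fieldType) H
    of GRing.Algebra K H & Coalgebra K H := {
  comul1 : comul (1 : H) = 1 ⊗ 1;
  comulM : forall g h : H, comul (g * h) =
    tlift (fun g1 g2 => tlift (fun h1 h2 => (g1 * h1) ⊗ (g2 * h2)) (comul h))
      (comul g);
  counit1 : counit (1 : H) = 1;
  counitM : forall g h : H, counit (g * h) = counit g * counit h
}.

#[short(type="bialgType")]
HB.structure Definition Bialgebra (K : fieldType) :=
  {H of isBialgebra K H & GRing.Algebra K H & Coalgebra K H}.

HB.mixin Record isHopfAlgebra (K : fieldType) H of Bialgebra K H := {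
  antipode : {linear H -> H};
  antipodel : forall h : H,
    tlift (fun h1 h2 => antipode h1 * h2) (comul h) = counit h *: 1;
  antipoder : forall h : H,
    tlift (fun h1 h2 => h1 * antipode h2) (comul h) = counit h *: 1
}.

#[short(type="hopfAlgType")]
HB.structure Definition HopfAlgebra (K : fieldType) :=
  {H of isHopfAlgebra K H & Bialgebra K H}.

Section LinearRetraction.
Variables (K : fieldType) (U V : lmodType K) (f : {linear U -> V}).
Hypothesis f_inj : injective f.

Let indep (A : set V) :=
  (forall a x y, A x -> A y -> A (a *: x + y)) /\ (forall u, A (f u) -> u = 0).

Let indep0 A : indep A -> forall x, A x -> A 0.
Proof. by move=> [Alin _] x Ax; rewrite -(addNr x) -scaleN1r; exact: Alin. Qed.

Let exists_complement : exists A, [/\ indep A, A 0 &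
  forall v, exists u, A (v - f u)].
Proof.
have [F Fi tot|A [iA maxA]] := @Zorn_bigcup V indep.
  split=> [a x y [X FX Xx] [Y FY Yy]|u [X FX Xu]]; last exact: (Fi _ FX).2.
  have [XY|YX] := tot _ _ FX FY.
    by exists Y => //; apply: (Fi _ FY).1 => //; exact: XY.
  by exists X => //; apply: (Fi _ FX).1 => //; exact: YX.
have A0 : A 0.
  apply: contrapT => nA0; apply: (maxA [set 0]).
    split=> [x Ax|/(_ 0 erefl)//].
    by case: nA0; exact: indep0 Ax.
  split=> [a x y -> ->|u /= fu0]; first by rewrite /= scaler0 addr0.
  by apply: f_inj; rewrite fu0 linear0.
exists A; split=> // v; apply: contrapT => nv.
have [Alin Af] := iA.
have AN x : A x -> A (- x).
  by move=> Ax; rewrite -scaleN1r -[_ *: _]addr0; exact: Alin.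
have AD x y : A x -> A y -> A (x + y).
  by move=> Ax Ay; rewrite -[x]scale1r; exact: Alin.
have AZ a x : A x -> A (a *: x).
  by move=> Ax; rewrite -[_ *: _]addr0; exact: Alin.
apply: (maxA [set x | exists a, A (x - a *: v)]).
  split=> [x Ax|AB]; first by exists 0; rewrite scale0r subr0.
  apply: nv; exists 0; rewrite linear0 subr0; apply: AB.
  by exists 1; rewrite scale1r subrr.
split=> [b x y [c Ax] [d Ay]|u [a Au]].
  exists (b * c + d); rewrite scalerDl -scalerA opprD addrACA -scalerBr.
  exact: Alin.
have [a0|a_neq0] := eqVneq a 0.
  by apply: Af; move: Au; rewrite a0 scale0r subr0.
case: nv; exists (a^-1 *: u); rewrite linearZ.
have -> : v - a^-1 *: f u = - (a^-1 *: (f u - a *: v)).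
  by rewrite scalerBr scalerA mulVf// scale1r opprB.
exact/AN/AZ.
Qed.

Lemma linear_retraction : exists g : {linear V -> U}, cancel f g.
Proof.
have [A [[Alin Af] A0 /choice[g gP]]] := exists_complement.
have guniq v u : A (v - f u) -> g v = u.
  move=> Au; apply/eqP; rewrite eq_sym -subr_eq0; apply/eqP/Af.
  rewrite linearB.
  have -> : f u - f (g v) = -1 *: (v - f u) + (v - f (g v)).
    by rewrite scaleN1r opprB addrA subrK.
  exact: Alin.
have glin : linear g.
  move=> a x y; apply: guniq; rewrite linearP opprD addrACA -scalerBr.
  exact: Alin.
pose gL := GRing.isLinear.Build K V U *:%R g glin.
pose gH : {linear V -> U} := HB.pack g gL.
by exists gH => u; apply: guniq; rewrite subrr.
Qed.

End LinearRetraction.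

Section TensorMapTheory.
Variable K : fieldType.

Lemma linear_tlift (U V W W' : lmodType K) (h : {linear W -> W'})
    (f : U -> V -> W) x :
  h (tlift f x) = tlift (fun u v => h (f u v)) x.
Proof. by rewrite /tlift raddf_sum. Qed.

Lemma tlift_tmap (U U' V V' W : lmodType K) (f : {linear U -> U'})
    (g : {linear V -> V'}) (b : U' -> V' -> W) x :
  bilinear_for *:%R *:%R b ->
  tlift b (tmap f g x) = tlift (fun u v => b (f u) (g v)) x.
Proof.
move=> bB.
pose bL := GRing.isLinear.Build K (tensor U' V') W *:%R (tlift b)
  (tlift_is_linear bB).
pose bH : {linear tensor U' V' -> W} := HB.pack (tlift b) bL.
rewrite -[LHS]/(bH (tmap f g x)) linear_tlift.
by apply: eq_tlift => u v; exact: tlift_tens.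
Qed.

Lemma tmap_tmap (U U' U'' V V' V'' : lmodType K)
    (f' : {linear U' -> U''}) (g' : {linear V' -> V''})
    (f : {linear U -> U'}) (g : {linear V -> V'}) x :
  tmap f' g' (tmap f g x) = tlift (fun u v => f' (f u) ⊗ g' (g v)) x.
Proof. exact/tlift_tmap/tmap_subproof. Qed.

Lemma tmap_inj (U U' V V' : lmodType K)
    (f : {linear U -> U'}) (g : {linear V -> V'}) :
  injective f -> injective g -> injective (tmap f g).
Proof.
move=> /linear_retraction[f' fK] /linear_retraction[g' gK].
apply: (can_inj (g := tmap f' g')) => x.
by rewrite tmap_tmap [RHS]tensorE; apply: eq_bigr => p _; rewrite fK gK.
Qed.

Lemma tassoc_tmap (U U' V V' W W' : lmodType K) (f : {linear U -> U'})
    (g : {linear V -> V'}) (h : {linear W -> W'}) x :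
  tassoc (tmap (tmap f g) h x) = tmap f (tmap g h) (tassoc x).
Proof.
pose l : {linear _ -> _} := @tassoc K U' V' W' \o tmap (tmap f g) h.
pose r : {linear _ -> _} := tmap f (tmap g h) \o @tassoc K U V W.
rewrite -[LHS]/(l x) -[RHS]/(r x) [x]tensorE !raddf_sum.
apply: eq_bigr => -[t w] _; rewrite [(t, w).1]tensorE linear_sumlz.
rewrite (raddf_sum l) (raddf_sum r); apply: eq_bigr => p _.
rewrite /l /r /reverse_coercion /= !(tassoc_tens, tmap_tens).
by rewrite /= !(tassoc_tens, tmap_tens).
Qed.

End TensorMapTheory.

(* comul maps S into the image of S (x) S in D (x) D. *)
HB.mixin Record isComulClosed (K : fieldType) (D : coalgType K)
    (S : {pred D}) := {
  comul_closed : forall c, c \in S ->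
    linear_span
      [set t | exists u v, [/\ u \in S, v \in S & t = u ⊗ v]] (comul c)
}.

#[short(type="subcoalgClosed")]
HB.structure Definition SubcoalgClosed (K : fieldType) (D : coalgType K) :=
  {S of isComulClosed K D S & GRing.AddClosed D S &
      GRing.isScaleClosed K D S}.

Section Subcoalgebra.
Variables (K : fieldType) (D : coalgType K) (S : subcoalgClosed D).

Record subcoalg : predArgType :=
  Subcoalg { subcoalg_val : D; _ : subcoalg_val \in S }.

HB.instance Definition _ := [isSub of subcoalg for subcoalg_val].
HB.instance Definition _ := [Choice of subcoalg by <:].
HB.instance Definition _ := [SubChoice_isSubLmodule of subcoalg by <:].

Lemma subcoalg_val_is_linear : linear subcoalg_val.
Proof. exact: linearP (\val : subcoalg -> D). Qed.

HB.instance Definition _ := GRing.isLinear.Build K subcoalg D *:%R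
  subcoalg_val subcoalg_val_is_linear.

Lemma subcoalg_val_inj : injective subcoalg_val.
Proof. exact: val_inj. Qed.

(* As tmap subcoalg_val subcoalg_val is injective, comul restricts uniquely  *)
(* to subcoalg -> tensor subcoalg subcoalg (subcoalg_comulE).                *)
Fact subcoalg_comul_subproof (c : subcoalg) :
  exists t, tmap subcoalg_val subcoalg_val t = comul (subcoalg_val c).
Proof.
have [s [sS ->]] := comul_closed _ (valP c).
elim: s sS => [|[a t] s ih] sS; first by exists 0; rewrite linear0 big_nil.
have [p ps|r rE] := ih; first by apply: sS; rewrite in_cons ps orbT.
have [u [v [Su Sv /= tE]]] := sS _ (mem_head _ _).
exists (a *: (Subcoalg Su ⊗ Subcoalg Sv) + r).
by rewrite linearP /reverse_coercion /= tmap_tens rE big_cons tE.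
Qed.

Definition subcoalg_comul (c : subcoalg) : tensor subcoalg subcoalg :=
  sval (cid (subcoalg_comul_subproof c)).

Lemma subcoalg_comulE c :
  tmap subcoalg_val subcoalg_val (subcoalg_comul c) = comul (subcoalg_val c).
Proof. exact: svalP (cid (subcoalg_comul_subproof c)). Qed.

Let tmap_val_inj :=
  tmap_inj subcoalg_val_inj subcoalg_val_inj.

Lemma subcoalg_comul_is_linear : linear subcoalg_comul.
Proof.
move=> a x y; apply: tmap_val_inj.
rewrite linearP /= !subcoalg_comulE !linearP; reflexivity.
Qed.

HB.instance Definition _ := GRing.isLinear.Build K subcoalg
  (tensor subcoalg subcoalg) *:%R subcoalg_comul subcoalg_comul_is_linear.

Definition subcoalg_counit (c : subcoalg) : K := counit (subcoalg_val c).

Lemma subcoalg_counit_is_scalar : scalar subcoalg_counit.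
Proof. by move=> a x y; rewrite /subcoalg_counit !linearP. Qed.

HB.instance Definition _ := GRing.isLinear.Build K subcoalg K *%R
  subcoalg_counit subcoalg_counit_is_scalar.

Lemma subcoalg_comulA c :
  tassoc (tmap subcoalg_comul idfun (subcoalg_comul c)) =
  tmap idfun subcoalg_comul (subcoalg_comul c).
Proof.
apply: (tmap_inj subcoalg_val_inj tmap_val_inj).
rewrite -tassoc_tmap !tmap_tmap.
have := comulA (subcoalg_val c); rewrite -subcoalg_comulE !tmap_tmap /=.
rewrite (eq_tlift (g := fun u v => tmap subcoalg_val subcoalg_val
  (subcoalg_comul u) ⊗ subcoalg_val v)); last first.
  by move=> u v; rewrite subcoalg_comulE.
move=> ->; apply: eq_tlift => u v /=.
by rewrite subcoalg_comulE.
Qed.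

Lemma subcoalg_counitl c :
  tlift (fun c1 c2 => subcoalg_counit c1 *: c2) (subcoalg_comul c) = c.
Proof.
apply: subcoalg_val_inj; rewrite linear_tlift -[RHS]counitl -subcoalg_comulE.
rewrite tlift_tmap.
  by apply: eq_tlift => u v; rewrite linearZ.
split=> z a x y /=.
  by rewrite linearP scalerDl scalerA.
by rewrite scalerDr !scalerA mulrC.
Qed.

Lemma subcoalg_counitr c :
  tlift (fun c1 c2 => subcoalg_counit c2 *: c1) (subcoalg_comul c) = c.
Proof.
apply: subcoalg_val_inj; rewrite linear_tlift -[RHS]counitr -subcoalg_comulE.
rewrite tlift_tmap.
  by apply: eq_tlift => u v; rewrite linearZ.
split=> z a x y /=.
  by rewrite scalerDr !scalerA mulrC.
by rewrite linearP scalerDl scalerA.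
Qed.

HB.instance Definition _ := Lmodule_isCoalgebra.Build K subcoalg
  subcoalg_comulA subcoalg_counitl subcoalg_counitr.

End Subcoalgebra.

Section ModuleCoalgebra.
(* Actions are not required to be compatible with the counits. *)
Variables (K : fieldType) (H : hopfAlgType K).

Definition module_coalgebra (D : coalgType K)
    (act : {linear tensor D H -> D}) : Prop :=
  [/\ forall d, act (d ⊗ 1) = d,
      forall d h, comul (act (d ⊗ h)) =
        tlift (fun d1 d2 =>
          tlift (fun h1 h2 => act (d1 ⊗ h1) ⊗ act (d2 ⊗ h2)) (comul h))
          (comul d)
    & forall d h g, act (act (d ⊗ h) ⊗ g) = act (d ⊗ (h * g))].

Definition partial_module_coalgebra (C : coalgType K)
    (act : {linear tensor C H -> C}) : Prop :=
  [/\ forall c, act (c ⊗ 1) = c,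
      forall c h, comul (act (c ⊗ h)) =
        tlift (fun c1 c2 =>
          tlift (fun h1 h2 => act (c1 ⊗ h1) ⊗ act (c2 ⊗ h2)) (comul h))
          (comul c)
    & forall c h g, act (act (c ⊗ h) ⊗ g) =
        tlift (fun c1 c2 =>
          tlift (fun h1 h2 =>
            counit (act (c1 ⊗ h1)) *: act (c2 ⊗ (h2 * g))) (comul h))
          (comul c)].

Variables (D : coalgType K) (act : {linear tensor D H -> D}).
Variable C : subcoalgClosed D.

Definition action_span : set D :=
  linear_span [set x | exists (c : subcoalg C) h, x = act (\val c ⊗ h)].

Definition is_projection (p : {linear D -> subcoalg C}) : Prop :=
  let pD x := \val (p x) in
  (forall x, pD (pD x) = pD x) /\ range pD = [set x | x \in C].

(* Preservation of the counit is not required. *)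
Definition comultiplicative (p : {linear D -> subcoalg C}) : Prop :=
  forall x, comul (p x) = tmap p p (comul x).

Definition induced_action (p : {linear D -> subcoalg C}) :
    {linear tensor (subcoalg C) H -> subcoalg C} :=
  p \o act \o tmap (@subcoalg_val K D C) idfun.

Lemma induced_action_tens p c h :
  induced_action p (c ⊗ h) = p (act (\val c ⊗ h)).
Proof. by rewrite /= tmap_tens. Qed.

End ModuleCoalgebra.

(* Main.v *)
From HB Require Import structures.
Require Import Defs.
From mathcomp Require Import all_boot all_algebra.
From mathcomp Require Import boolp classical_sets.

(** Write [x = c ◂ h], with [c] in [C].  The comultiplication of [D] sends [x]
    to [c1 ◂ h1 ⊗ c2 ◂ h2], where [c1] and [c2] can be taken in [C] because
    [C] is a subcoalgebra ([comul_act_subcoalg]).  The three axioms of a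
    partial module coalgebra follow.

    - The unit axiom holds because [p] restricts to the identity of [C].
    - Applying [p ⊗ p] to the formula above, and using that [p] is
      comultiplicative, gives the comultiplication axiom.
    - Since [x] lies in the span of [C ◂ H], the compatibility condition on
      [p] rewrites [p (p x ◂ g)] as [p (ε(p x1) x2 ◂ g)].  The formula turns
      this into [ε(p (c1 ◂ h1)) p ((c2 ◂ h2) ◂ g)], and associativity of the
      action on [D] replaces [(c2 ◂ h2) ◂ g] by [c2 ◂ (h2 g)].

    What remains is to move linear maps through nested Sweedler sums.  An
    expression [tlift f x] is well behaved only for bilinear [f], so the work
    lies in checking bilinearity where a sum is substituted in another one. *)

Set Implicit Arguments.
Unset Strict Implicit.
Unset Printing Implicit Defensive.

Import GRing.Theory.

Local Open Scope ring_scope.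

Lemma tlift_tlift (K : fieldType) (U V U' V' W : lmodType K)
    (b : U' -> V' -> W) (f : U -> V -> tensor U' V') x :
  bilinear_for *:%R *:%R b ->
  tlift b (tlift f x) = tlift (fun u v => tlift b (f u v)) x.
Proof.
move=> bB.
pose bL := GRing.isLinear.Build K (tensor U' V') W *:%R (tlift b)
  (tlift_is_linear bB).
pose bH : {linear tensor U' V' -> W} := HB.pack (tlift b) bL.
exact: (linear_tlift bH).
Qed.

(** This makes nested Sweedler sums legitimate: the inner sum over [t] is
    bilinear in the variables of the outer one as soon as its terms are. *)
Lemma tlift_bilinear (K : fieldType) (U V U' V' W : lmodType K)
    (f : U -> V -> U' -> V' -> W) (t : tensor U' V') :
  (forall u' v', bilinear_for *:%R *:%R (fun u v => f u v u' v')) ->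
  bilinear_for *:%R *:%R (fun u v => tlift (f u v) t).
Proof.
move=> fB; split=> w a x y; rewrite /= /tlift scaler_sumr -big_split /=.
  by apply: eq_bigr => q _; exact: (fB q.1 q.2).1.
by apply: eq_bigr => q _; exact: (fB q.1 q.2).2.
Qed.

Lemma counit_scale_bilinear (K : fieldType) (V : lmodType K)
    (C : coalgType K) (f : {linear V -> C}) :
  bilinear_for *:%R *:%R (fun u v : V => counit (f u) *: v).
Proof.
split=> w a x y /=; first by rewrite !linearP scalerDl scalerA.
by rewrite scalerDr !scalerA mulrC.
Qed.

Lemma projection_id (K : fieldType) (D : coalgType K) (C : subcoalgClosed D)
    (p : {linear D -> subcoalg C}) (c : subcoalg C) :
  is_projection p -> p (\val c) = c.
Proof.
move=> [pp range_p]; apply: val_inj.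
have : [set x | x \in C]%classic (\val c) by exact: valP c.
by rewrite -range_p => -[y _ <-]; exact: pp.
Qed.

(** The comultiplication of a subcoalgebra is the restriction of that of [D],
    so the sum over the Sweedler components of [\val c] in [D] can be
    reindexed by those of [c]; the induced action is defined only there. *)
Lemma comul_act_subcoalg (K : fieldType) (H : hopfAlgType K)
    (D : coalgType K) (act : {linear tensor D H -> D})
    (C : subcoalgClosed D) (c : subcoalg C) (h : H) :
  module_coalgebra act ->
  comul (act (\val c ⊗ h)) =
    tlift (fun c1 c2 =>
      tlift (fun h1 h2 => act (\val c1 ⊗ h1) ⊗ act (\val c2 ⊗ h2)) (comul h))
      (comul c).
Proof.
move=> [_ comul_act _].
rewrite comul_act -[comul (\val c)]subcoalg_comulE tlift_tmap //.
apply: tlift_bilinear => h1 h2; split=> w a x y /=.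
  by rewrite linearPl linearP linearPl.
by rewrite linearPl linearP linearPr.
Qed.

Theorem proposition3p18 (K : fieldType) (H : hopfAlgType K) (D : coalgType K)
    (act : {linear tensor D H -> D}) (C : subcoalgClosed D)
    (p : {linear D -> subcoalg C}) :
  module_coalgebra act ->
  is_projection p ->
  comultiplicative p ->
  (forall (x : D) (h : H), action_span act C x ->
     p (act (subcoalg_val (p x) ⊗ h)) =
     p (act (tlift (fun x1 x2 => counit (p x1) *: x2) (comul x) ⊗ h))) ->
  partial_module_coalgebra (induced_action act p).
Proof.
move=> act_mod p_proj p_comul p_act; have [act1 _ actA] := act_mod.
split=> [c|c h|c h g].
- by rewrite induced_action_tens act1 projection_id.
- rewrite induced_action_tens p_comul comul_act_subcoalg // linear_tlift.
  apply: eq_tlift => c1 c2; rewrite linear_tlift.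
  by apply: eq_tlift => h1 h2; rewrite !induced_action_tens /= tmap_tens.
rewrite !induced_action_tens p_act; last first.
  exists [:: (1, act (\val c ⊗ h))]; split=> [q|].
    by rewrite inE => /eqP ->; exists c, h.
  by rewrite big_seq1 scale1r.
rewrite comul_act_subcoalg //.
have bB := counit_scale_bilinear p.
rewrite (tlift_tlift _ _ bB).
(* [d ↦ p (d ◂ g)] as a linear map, to be pushed into both Sweedler sums. *)
pose pact_g : {linear D -> subcoalg C} := p \o act \o applyr tens g.
rewrite -[LHS]/(pact_g _) linear_tlift; apply: eq_tlift => c1 c2.
rewrite (tlift_tlift _ _ bB) linear_tlift; apply: eq_tlift => h1 h2.
by rewrite !induced_action_tens (tlift_tens bB) linearZ /pact_g /= actA.
Qed.
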